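(* Let $\gamma\ge 1$ and let $\mathcal{N}$ be a quantum channel whose input Hilbert space $\mathcal{H}$ is finite-dimensional with $\dim\mathcal{H}\ge 2$. Then $$\eta_\gamma(\mathcal{N})=\sup_{|\varphi\rangle\perp|\psi\rangle}E_\gamma\big(\mathcal{N}(|\varphi\rangle\langle\varphi|)\,\big\|\,\mathcal{N}(|\psi\rangle\langle\psi|)\big),$$ where the supremum runs over all pairs of orthogonal unit vectors $|\varphi\rangle,|\psi\rangle\in\mathcal{H}$.
   Context: All Hilbert spaces are finite-dimensional complex. A quantum state is a positive semidefinite operator of unit trace. A quantum channel is a linear completely positive trace-preserving map. For a Hermitian operator $X$, $X=X^+-X^-$ is the decomposition into positive and negative parts from the spectral decomposition. For $\gamma\ge1$ and positive semidefinite $\rho,\sigma$, the quantum hockey-stick divergence is $E_\gamma(\rho\|\sigma)=\operatorname{Tr}(\rho-\gamma\sigma)^+$. The contraction coefficient is $$\eta_\gamma(\mathcal{N})=\sup_{\rho,\sigma}\frac{E_\gamma(\mathcal{N}(\rho)\|\mathcal{N}(\sigma))}{E_\gamma(\rho\|\sigma)},$$ the supremum being over pairs of quantum states $\rho,\sigma$ on the input space with $E_\gamma(\rho\|\sigma)>0$. *)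

(* Defs.v *)
From HB Require Import structures.
From mathcomp Require Import all_boot all_order all_algebra.
From mathcomp Require Import complex.
From mathcomp Require Import all_classical all_reals ereal.

Set Implicit Arguments.
Unset Strict Implicit.
Unset Printing Implicit Defensive.

Import Order.TTheory GRing.Theory Num.Theory.
Local Open Scope ring_scope.
Local Open Scope sesquilinear_scope.
Local Open Scope complex_scope.
Local Open Scope classical_set_scope.

(* A Hilbert space of dimension n is C^n with C = R[i]; its vectors are columns
   and its operators are n x n matrices. *)

Section Quantum.
Variable R : realType.
Local Notation C := R[i].

(* The inner product, antilinear in the first argument. *)
Definition braket n (phi psi : 'cV[C]_n) : C := (phi ^t* *m psi) 0 0.

Definition ketbra n (phi : 'cV[C]_n) : 'M[C]_n := phi *m phi ^t*.

Definition unit_vector n (phi : 'cV[C]_n) : Prop := braket phi phi = 1.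

Definition orthogonal_vectors n (phi psi : 'cV[C]_n) : Prop :=
  braket phi psi = 0.

(* In the order of R[i], 0 <= z says that z is real and nonnegative. *)
Definition psd n (A : 'M[C]_n) : Prop :=
  A \is hermsymmx /\ forall v : 'cV[C]_n, 0 <= braket v (A *m v).

Definition is_state n (rho : 'M[C]_n) : Prop := psd rho /\ \tr rho = 1.

(* id_k (x) N: an operator on C^k (x) C^n is a k x k array of n x n blocks,
   and the map acts on each block. *)
Definition ampliation k n m (N : 'M[C]_n -> 'M[C]_m)
    (X : 'M[C]_(\sum_(i < k) n)) : 'M[C]_(\sum_(i < k) m) :=
  \mxblock_(i < k, j < k) N (submxblock X i j).

Definition completely_positive n m (N : 'M[C]_n -> 'M[C]_m) : Prop :=
  forall k (X : 'M[C]_(\sum_(i < k) n)), psd X -> psd (ampliation N X).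

Definition trace_preserving n m (N : 'M[C]_n -> 'M[C]_m) : Prop :=
  forall X, \tr (N X) = \tr X.

Definition is_channel n m (N : {linear 'M[C]_n -> 'M[C]_m}) : Prop :=
  completely_positive N /\ trace_preserving N.

(* X^+, for X Hermitian: X = P^-1 D P with P = spectralmx X unitary and
   D = diag_mx (spectral_diag X) real, so that max(_, 0) is the maximum of two
   comparable elements of R[i]. *)
Definition pos_part n (X : 'M[C]_n) : 'M[C]_n :=
  invmx (spectralmx X)
  *m diag_mx (map_mx (fun l : C => Num.max l 0) (spectral_diag X))
  *m spectralmx X.

(* The trace is real for Hermitian rho and sigma. *)
Definition hockey_stick (gamma : R) n (rho sigma : 'M[C]_n) : R :=
  complex.Re (\tr (pos_part (rho - gamma%:C *: sigma))).

(* The supremum is taken in the extended reals, where it always exists. *)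
Definition contraction_coefficient (gamma : R) n m
    (N : 'M[C]_n -> 'M[C]_m) : \bar R :=
  ereal_sup [set e | exists rho sigma : 'M[C]_n,
    [/\ is_state rho, is_state sigma, 0 < hockey_stick gamma rho sigma
      & e = (hockey_stick gamma (N rho) (N sigma)
             / hockey_stick gamma rho sigma)%:E]].

End Quantum.

(* Main.v *)
(* For states rho, sigma put X = rho - gamma sigma = sum_i d_i |u_i><u_i| and
   E = tr X^+, F = tr X^-. Then F = E + gamma - 1, and E <= 1 gives
   F - gamma E = (gamma - 1) (1 - E) >= 0. Let a(Z) = tr (M N(Z)) with M the
   projector onto the positive part of N(X), so that a(X) is the divergence of
   the outputs. If s bounds the divergence for all orthogonal pure pairs, then
   a(|u_k><u_k|) - gamma a(|u_l><u_l|) <= s whenever d_k > 0 >= d_l; averaging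
   with weights d_k |d_l| and using F >= gamma E yields a(X) <= s E. Conversely
   orthogonal pure states have divergence 1, so their ratios are the right-hand
   side. *)
Require Import Defs.
From HB Require Import structures.
From mathcomp Require Import all_boot all_order all_algebra.
From mathcomp Require Import complex.
From mathcomp Require Import all_classical all_reals ereal.
From mathcomp Require Import ring lra.

Import Order.TTheory GRing.Theory Num.Theory.
Local Open Scope ring_scope.
Local Open Scope complex_scope.
Local Open Scope classical_set_scope.

Section Hermitian.
Set Implicit Arguments.
Unset Strict Implicit.
Local Open Scope sesquilinear_scope.
Variable R : realType.
Local Notation C := R[i].

(** * Inner products, quadratic forms and positive semidefinite operators *)

Lemma braketC n (u v : 'cV[C]_n) : (braket u v)^*%R = braket v u.
Proof.
rewrite /braket !mxE rmorph_sum; apply: eq_bigr => i _.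
by rewrite !mxE rmorphM /= conjCK mulrC.
Qed.

(** The form <v|A|v>, named so that it can be registered as linear in A and expanded over spectral
    sums. *)
Definition quad n (v : 'cV[C]_n) (A : 'M[C]_n) : C := braket v (A *m v).

Lemma quad_trace n (v : 'cV[C]_n) A : quad v A = \tr (A *m ketbra v).
Proof. by rewrite /quad /braket /ketbra mulmxA mxtrace_mulC trace_mx11 mulmxA. Qed.

Lemma psd_quad_ge0 n (v : 'cV[C]_n) A : psd A -> 0 <= quad v A.
Proof. by case=> _; apply. Qed.

Lemma quad_is_linear n (v : 'cV[C]_n) : scalar (quad v).
Proof. by move=> a A B; rewrite !quad_trace mulmxDl -scalemxAl linearP. Qed.

HB.instance Definition _ n (v : 'cV[C]_n) :=
  GRing.isLinear.Build C 'M[C]_n C *%R (quad v) (quad_is_linear v).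

Lemma quad_ketbra n (u v : 'cV[C]_n) : quad v (ketbra u) = `|braket u v| ^+ 2.
Proof.
rewrite normCK braketC /quad /ketbra /braket !mulmxA -mulmxA mulrC.
by rewrite [LHS]mxE big_ord1.
Qed.

Lemma trace_ketbra n (u : 'cV[C]_n) : \tr (ketbra u) = braket u u.
Proof. by rewrite /ketbra mxtrace_mulC trace_mx11. Qed.

Lemma hermsymmxP n (A : 'M[C]_n) : reflect (A ^t* = A) (A \is hermsymmx).
Proof.
apply: (iffP (is_hermitianmxP _ _ _)); rewrite expr0 scale1r => h; first by rewrite -h.
by rewrite h.
Qed.

Lemma hermsymmxD n (A B : 'M[C]_n) :
  A \is hermsymmx -> B \is hermsymmx -> A + B \is hermsymmx.
Proof.
move=> /hermsymmxP hA /hermsymmxP hB; apply/hermsymmxP.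
by rewrite linearD /= map_mxD hA hB.
Qed.

Lemma hermsymmxZ n (a : C) (A : 'M[C]_n) :
  a \is Num.real -> A \is hermsymmx -> a *: A \is hermsymmx.
Proof.
move=> /CrealP ha /hermsymmxP hA; apply/hermsymmxP.
by rewrite linearZ /= map_mxZ /= hA ha.
Qed.

Lemma psd_ketbra n (u : 'cV[C]_n) : psd (ketbra u).
Proof.
split; last by move=> v; rewrite -/(quad v _) quad_ketbra exprn_ge0.
by apply/hermsymmxP; rewrite /ketbra trmx_mul map_mxM trmxCK.
Qed.

Lemma ketbra_state n (u : 'cV[C]_n) : unit_vector u -> is_state (ketbra u).
Proof. by move=> hu; split; [exact: psd_ketbra | rewrite trace_ketbra]. Qed.

Lemma psd0 n : psd (0 : 'M[C]_n).
Proof.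
split; first by apply/hermsymmxP; rewrite trmx0 map_mx0.
by move=> v; rewrite -/(quad v 0) linear0.
Qed.

Lemma psdD n (A B : 'M[C]_n) : psd A -> psd B -> psd (A + B).
Proof.
move=> [hA pA] [hB pB]; split; first exact: hermsymmxD.
by move=> v; rewrite -/(quad v _) linearD addr_ge0 ?psd_quad_ge0.
Qed.

Lemma psdZ n (a : C) (A : 'M[C]_n) : 0 <= a -> psd A -> psd (a *: A).
Proof.
move=> a0 [hA pA]; split; first exact: hermsymmxZ (ger0_real a0) hA.
by move=> v; rewrite -/(quad v _) linearZ mulr_ge0 ?psd_quad_ge0.
Qed.

Lemma psd_sum n (I : finType) (P : pred I) (F : I -> 'M[C]_n) :
  (forall i, P i -> psd (F i)) -> psd (\sum_(i | P i) F i).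
Proof. by move=> hF; elim/big_ind: _ => //; [exact: psd0 | exact: psdD]. Qed.

(** * Orthonormal bases given by the rows of a unitary matrix *)

(* For unitary P these are the columns of P^-1, so that P^-1 D P is the sum of
   the d_i |frame P i><frame P i|. *)
Definition frame n (P : 'M[C]_n) (i : 'I_n) : 'cV[C]_n := (row i P)^t*.

Lemma frame_orthonormal n (P : 'M[C]_n) i j : P \is unitarymx ->
  braket (frame P i) (frame P j) = (i == j)%:R.
Proof.
move=> /row_unitarymxP /(_ i j); rewrite dotmxE => <-.
by rewrite /braket /frame trmxCK.
Qed.

Lemma conj_diag_frame n (P : 'M[C]_n) (d : 'rV[C]_n) :
  P^t* *m diag_mx d *m P = \sum_i d 0 i *: ketbra (frame P i).
Proof.
apply/matrixP => a b; rewrite mul_mx_diag summxE !mxE; apply: eq_bigr => i _.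
by rewrite !mxE big_ord1 !mxE conjCK mulrAC mulrC mulrA.
Qed.

(** Completeness relation: the case D = 1 of [conj_diag_frame]. The basis formula for the trace and
    Parseval's identity follow from it. *)
Lemma sum_ketbra_frame n (P : 'M[C]_n) : P \is unitarymx ->
  \sum_i ketbra (frame P i) = 1%:M.
Proof.
move=> hP; have := conj_diag_frame P (const_mx 1).
rewrite diag_const_mx mulmx1 -invmx_unitary // mulVmx ?unitarymx_unit // => ->.
by apply: eq_bigr => i _; rewrite mxE scale1r.
Qed.

Lemma sum_quad_frame n (P A : 'M[C]_n) : P \is unitarymx ->
  \sum_i quad (frame P i) A = \tr A.
Proof.
move=> hP; rewrite -[in RHS](mulmx1 A) -(sum_ketbra_frame hP) mulmx_sumr linear_sum.
by apply: eq_bigr => i _; rewrite quad_trace.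
Qed.

Lemma sum_braket_frame n (P : 'M[C]_n) v : P \is unitarymx ->
  \sum_i `|braket (frame P i) v| ^+ 2 = braket v v.
Proof.
move=> hP; rewrite -[X in _ = braket _ X]mul1mx -(sum_ketbra_frame hP) -/(quad v _).
by rewrite linear_sum; apply: eq_bigr => i _; rewrite /= quad_ketbra.
Qed.

(** * Spectral decomposition and the positive part of a Hermitian operator *)

Section Spectral.
Variables (n : nat) (X : 'M[C]_n).
Hypothesis hX : X \is hermsymmx.

Definition eigvec := frame (spectralmx X).
Definition eigval i := spectral_diag X 0 i.

Lemma eigval_real i : eigval i \is Num.real.
Proof. exact/mxOverP/hermitian_spectral_diag_real. Qed.

Lemma eigvec_orthonormal i j : braket (eigvec i) (eigvec j) = (i == j)%:R.
Proof. exact/frame_orthonormal/spectral_unitarymx. Qed.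

Lemma spectral_decomposition : X = \sum_i eigval i *: ketbra (eigvec i).
Proof.
have /hermitian_normalmx/orthomx_spectralP h := hX.
by rewrite -conj_diag_frame -invmx_unitary ?spectral_unitarymx.
Qed.

Lemma pos_part_decomposition :
  pos_part X = \sum_i Num.max (eigval i) 0 *: ketbra (eigvec i).
Proof.
rewrite /pos_part invmx_unitary ?spectral_unitarymx // conj_diag_frame.
by apply: eq_bigr => i _; rewrite mxE.
Qed.

(** The order of [C] is partial; the maximum behaves as expected because eigenvalues are real, hence
    comparable to 0. *)
Lemma max_eigval_ge0 i : 0 <= Num.max (eigval i) 0.
Proof. by rewrite comparable_le_max ?lexx ?orbT // comparabler0 eigval_real. Qed.

Lemma psd_pos_part : psd (pos_part X).
Proof.
rewrite pos_part_decomposition; apply: psd_sum => i _.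
exact: psdZ (max_eigval_ge0 i) (psd_ketbra _).
Qed.

(** This operator is X^-, diagonal in the eigenbasis of X with entries max(d_i, 0) - d_i. *)
Lemma psd_pos_partB : psd (pos_part X - X).
Proof.
rewrite pos_part_decomposition [X in _ - X]spectral_decomposition -sumrB.
apply: psd_sum => i _; rewrite -scalerBl; apply: psdZ (psd_ketbra _).
by rewrite subr_ge0 comparable_le_max ?lexx // comparabler0 eigval_real.
Qed.

Lemma trace_spectral : \tr X = \sum_i eigval i.
Proof.
rewrite [in LHS]spectral_decomposition linear_sum; apply: eq_bigr => i _ /=.
by rewrite linearZ /= trace_ketbra eigvec_orthonormal eqxx mulr1.
Qed.

Lemma quad_eigvec i : quad (eigvec i) X = eigval i.
Proof.
rewrite [X in quad _ X]spectral_decomposition linear_sum (bigD1 i) //=.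
rewrite big1 => [|j ji]; rewrite linearZ /= quad_ketbra eigvec_orthonormal.
  by rewrite eqxx normr1 expr1n mulr1 addr0.
by rewrite (negPf ji) normr0 expr0n mulr0.
Qed.

Lemma trace_pos_part : \tr (pos_part X) = \sum_(i | 0 < eigval i) eigval i.
Proof.
rewrite pos_part_decomposition linear_sum [RHS]big_mkcond; apply: eq_bigr => i _ /=.
rewrite linearZ /= trace_ketbra eigvec_orthonormal eqxx mulr1.
have := eigval_real i; rewrite realE => /orP[].
  by rewrite le_eqVlt => /predU1P[<-|h]; rewrite ?ltxx ?maxxx // h max_l // ltW.
by move=> h; rewrite max_r // le_gtF.
Qed.

Lemma trace_pos_part_ge0 : 0 <= \tr (pos_part X).
Proof. by rewrite trace_pos_part sumr_ge0 // => i /ltW. Qed.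

(* Ky Fan: X <= X^+ and 0 <= X^+. *)
Lemma quad_le_trace_pos_part (P : 'M[C]_n) (J : pred 'I_n) : P \is unitarymx ->
  \sum_(j | J j) quad (frame P j) X <= \tr (pos_part X).
Proof.
move=> hP; rewrite -(sum_quad_frame _ hP) [X in _ <= X](bigID J) /=.
rewrite -[X in X <= _]addr0 lerD ?sumr_ge0 //; last first.
  by move=> j _; exact/psd_quad_ge0/psd_pos_part.
apply: ler_sum => j _; rewrite -subr_ge0 -linearB; exact/psd_quad_ge0/psd_pos_partB.
Qed.

(** Since X <= X^+, it suffices to bound <v|X^+|v>, where each weight |<u_i|v>|^2 is at most 1 by
    Parseval. *)
Lemma quad_unit_le_trace_pos_part v : unit_vector v -> quad v X <= \tr (pos_part X).
Proof.
move=> hv; apply: (@le_trans _ _ (quad v (pos_part X))).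
  by rewrite -subr_ge0 -linearB; exact/psd_quad_ge0/psd_pos_partB.
rewrite pos_part_decomposition !linear_sum; apply: ler_sum => i _ /=.
rewrite !linearZ /= trace_ketbra eigvec_orthonormal eqxx ler_wpM2l ?max_eigval_ge0 //.
rewrite quad_ketbra -hv -(sum_braket_frame v (spectral_unitarymx X)) (bigD1 i) //=.
by rewrite lerDl sumr_ge0 // => j _; rewrite exprn_ge0.
Qed.

End Spectral.

(** * Elementary bounds on the hockey-stick divergence *)

Section HockeyStick.
Variables (gamma : R) (n : nat).
Hypothesis hgamma : 1 <= gamma.
Implicit Types rho sigma : 'M[C]_n.

Lemma hermsymmx_hockey rho sigma : psd rho -> psd sigma ->
  rho - gamma%:C *: sigma \is hermsymmx.
Proof.
move=> [hr _] [hs _]; rewrite -scaleNr hermsymmxD // hermsymmxZ //.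
by rewrite realN; apply/complex_realP; exists gamma.
Qed.

(** The trace is nonnegative, hence real, so the real part loses nothing and inequalities can be
    proved in [C]. *)
Lemma hockey_stickE rho sigma : psd rho -> psd sigma ->
  (hockey_stick gamma rho sigma)%:C = \tr (pos_part (rho - gamma%:C *: sigma)).
Proof.
move=> hr hs; rewrite RRe_real // ger0_real // trace_pos_part_ge0 //.
exact: hermsymmx_hockey.
Qed.

(** Each positive eigenvalue is <u|rho|u> - gamma <u|sigma|u> <= <u|rho|u>, and summing the latter
    over the whole eigenbasis gives the trace. For states this is E <= 1. *)
Lemma hockey_stick_le_trace rho sigma : psd rho -> psd sigma ->
  (hockey_stick gamma rho sigma)%:C <= \tr rho.
Proof.
move=> hr hs; have hX := hermsymmx_hockey hr hs.
rewrite hockey_stickE // trace_pos_part //.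
rewrite -(sum_quad_frame rho (spectral_unitarymx (rho - gamma%:C *: sigma))).
rewrite [X in _ <= X](bigID (fun i => 0 < eigval (rho - gamma%:C *: sigma) i)) /=.
rewrite -[X in X <= _]addr0 lerD ?sumr_ge0 //; last by move=> j _; exact: psd_quad_ge0.
apply: ler_sum => j _; rewrite -quad_eigvec // -/(eigvec _ j).
move: (eigvec _ j) => v; rewrite linearB linearZ /= lerBlDr lerDl.
rewrite mulr_ge0 ?psd_quad_ge0 //.
by rewrite lecR (le_trans ler01).
Qed.

Lemma hockey_stick_orthogonal (phi psi : 'cV[C]_n) :
  unit_vector phi -> unit_vector psi -> orthogonal_vectors phi psi ->
  hockey_stick gamma (ketbra phi) (ketbra psi) = 1.
Proof.
move=> h1 h2 h3; apply: complexI; apply/le_anti/andP; split.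
  rewrite (le_trans (hockey_stick_le_trace (psd_ketbra _) (psd_ketbra _))) //.
  by rewrite trace_ketbra h1.
rewrite hockey_stickE; try exact: psd_ketbra.
(* Test with phi itself: orthogonality kills the psi term, leaving the value 1. *)
apply: le_trans (quad_unit_le_trace_pos_part _ h1); last first.
  by apply: hermsymmx_hockey; exact: psd_ketbra.
rewrite linearB linearZ /= !quad_ketbra h1 normr1 expr1n.
by rewrite -braketC h3 conjC0 normr0 expr0n mulr0 subr0.
Qed.

End HockeyStick.

(** * From complete positivity to positivity *)

Lemma trmxC_mxblock k n (B : 'I_k -> 'I_k -> 'M[C]_n) :
  (\mxblock_(i, j) B i j)^t* = \mxblock_(i, j) (B j i)^t*.
Proof. by apply/matrixP => i j; rewrite !mxE. Qed.

Lemma trmxC_mxcol k n p (B : 'I_k -> 'M[C]_(n, p)) :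
  (\mxcol_i B i)^t* = \mxrow_i (B i)^t*.
Proof. by apply/matrixP => i j; rewrite !mxE. Qed.

(** Identifies C^1 (x) C^n with C^n, whose index types differ, so that complete positivity at k = 1
    yields positivity of the map. *)
Lemma psd_mxblock1 n (A : 'M[C]_n) :
  psd (\mxblock_(i < 1, j < 1) A) <-> psd A.
Proof.
have quad1 (v : 'I_1 -> 'cV[C]_n) :
    quad (\mxcol_i v i) (\mxblock_(i < 1, j < 1) A) = quad (v ord0) A.
  by rewrite /quad /braket mul_mxblock_mxrow trmxC_mxcol mul_mxrow_mxcol !big_ord1.
split=> [[/hermsymmxP hB pB]|[/hermsymmxP hA pA]]; split.
- apply/hermsymmxP; have /(congr1 (fun B => submxblock B ord0 ord0)) := hB.
  by rewrite trmxC_mxblock !mxblockK.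
- by move=> v; have := pB (\mxcol_(i < 1) v); rewrite -/(quad _ _) quad1.
- by apply/hermsymmxP; rewrite trmxC_mxblock hA.
- by move=> v; rewrite -/(quad v _) -(submxcolK v) quad1; exact: pA.
Qed.

Lemma completely_positive_psd n m (N : 'M[C]_n -> 'M[C]_m) A :
  completely_positive N -> psd A -> psd (N A).
Proof.
move=> hN /psd_mxblock1/hN; rewrite /ampliation => hA; apply/psd_mxblock1.
by congr psd: hA; apply: eq_mxblock => i j; rewrite mxblockK.
Qed.

(** * The averaging argument and the contraction bound *)

Lemma weighted_pairs_le (K : numDomainType) (I : finType) (P Q : pred I)
    (w w' a : I -> K) (c s : K) :
  (forall k, P k -> 0 <= w k) -> (forall l, Q l -> 0 <= w' l) ->
  (forall k l, P k -> Q l -> a k - c * a l <= s) ->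
  (\sum_(l | Q l) w' l) * (\sum_(k | P k) w k * a k)
    - c * (\sum_(k | P k) w k) * (\sum_(l | Q l) w' l * a l)
  <= s * (\sum_(k | P k) w k) * (\sum_(l | Q l) w' l).
Proof.
move=> hw hw' ha.
(* Both sides become double sums over (k, l), compared termwise with weight w_k w'_l >= 0. *)
rewrite [X in X - _]mulrC -[c * _ * _]mulrA -[s * _ * _]mulrA.
rewrite !big_distrlr /= !mulr_sumr -sumrB; apply: ler_sum => k Pk.
rewrite !mulr_sumr -sumrB; apply: ler_sum => l Ql.
have -> : w k * a k * w' l - c * (w k * (w' l * a l)) =
    (a k - c * a l) * (w k * w' l) by ring.
by rewrite ler_wpM2r ?ha // mulr_ge0 ?hw ?hw'.
Qed.

(** The upper bound for a fixed real s and without division, so that no supremum enters the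
    averaging. *)
Lemma hockey_stick_channel_le (gamma s : R) n m (N : {linear 'M[C]_n -> 'M[C]_m})
    (rho sigma : 'M[C]_n) :
  1 <= gamma -> completely_positive N -> is_state rho -> is_state sigma ->
  0 < hockey_stick gamma rho sigma ->
  (forall phi psi : 'cV[C]_n,
     unit_vector phi -> unit_vector psi -> orthogonal_vectors phi psi ->
     hockey_stick gamma (N (ketbra phi)) (N (ketbra psi)) <= s) ->
  hockey_stick gamma (N rho) (N sigma) <= s * hockey_stick gamma rho sigma.
Proof.
move=> hg hN [hr tr] [hs ts] E0 hpair.
have Npsd A : psd A -> psd (N A) by exact: completely_positive_psd.
have [hNr hNs] := (Npsd _ hr, Npsd _ hs).
have hX := hermsymmx_hockey gamma hr hs.
have hY := hermsymmx_hockey gamma hNr hNs.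
have E1 := hockey_stick_le_trace hg hr hs; rewrite tr lecR in E1.
have EE := hockey_stickE gamma hr hs; have HE := hockey_stickE gamma hNr hNs.
set E := hockey_stick gamma rho sigma in E0 E1 EE *.
set H := hockey_stick gamma (N rho) _ in HE *.
set X := rho - _ in hX EE; set Y := N rho - _ in hY HE.
have YE : Y = N X by rewrite linearB linearZ.
pose a Z := \sum_(j | 0 < eigval Y j) quad (eigvec Y j) (N Z).
pose d := eigval X; pose K i := ketbra (eigvec X i).
rewrite trace_pos_part // -/d in EE.
have HaX : H%:C = \sum_k d k * a (K k).
  rewrite HE trace_pos_part //.
  (* H = a(X), because the positive eigenvalues of Y = N(X) are the values of its form at its own
     eigenvectors; linearity then expands X. *)
  transitivity (a X).
    by apply: eq_bigr => j _; rewrite -YE quad_eigvec.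
  rewrite /a; under [RHS]eq_bigr do rewrite mulr_sumr.
  rewrite [RHS]exchange_big /=; apply: eq_bigr => j _.
  move: (eigvec Y j) => v; rewrite [in LHS](spectral_decomposition hX) !linear_sum.
  by apply: eq_bigr => i _; rewrite !linearZ.
have a_ge0 k : 0 <= a (K k).
  by apply: sumr_ge0 => j _; apply/psd_quad_ge0/Npsd/psd_ketbra.
have pairs k l : 0 < d k -> ~~ (0 < d l) -> a (K k) - gamma%:C * a (K l) <= s%:C.
  move=> dk dl; have kl : k != l by apply: contraNneq dl => <-.
  apply: (@le_trans _ _ (hockey_stick gamma (N (K k)) (N (K l)))%:C); last first.
    rewrite lecR hpair /unit_vector /orthogonal_vectors ?eigvec_orthonormal ?eqxx //.
    by rewrite (negPf kl).
  rewrite hockey_stickE; try exact/Npsd/psd_ketbra.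
  have hZ := hermsymmx_hockey gamma (Npsd _ (psd_ketbra (eigvec X k)))
    (Npsd _ (psd_ketbra (eigvec X l))).
  (* Ky Fan for the output pair, tested on the eigenbasis of Y rather than on that of the pair. *)
  apply: le_trans (quad_le_trace_pos_part hZ _ (spectral_unitarymx Y)).
  rewrite /a mulr_sumr -sumrB; apply: ler_sum => j _.
  rewrite -/(eigvec Y j); move: (eigvec Y j) => v.
  by rewrite [leRHS]linearB [in leRHS]linearZ.
have d_le0 l : ~~ (0 < d l) -> 0 <= - d l.
  by rewrite oppr_ge0 real_leNgt ?real0 // eigval_real.
have := weighted_pairs_le (fun k => @ltW _ _ 0 (d k)) d_le0 pairs.
set F := \sum_(l | _) - d l; rewrite -EE.
set al := \sum_(k | _) _; set be := \sum_(k | _) _ => key.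
have be_ge0 : 0 <= be by apply: sumr_ge0 => l dl; rewrite mulr_ge0 ?d_le0.
(* Split by the sign of d_k; the nonpositive eigenvalues enter [be] with weights -d_l >= 0. *)
have HH : H%:C = al - be.
  rewrite HaX (bigID (fun k => 0 < d k)) /=; congr +%R; rewrite /be.
  by rewrite -sumrN; apply: eq_bigr => l _; rewrite mulNr opprK.
(* Compare tr X = 1 - gamma with tr X = E - F. *)
have FE : F = (E + gamma - 1)%:C.
  have := trace_spectral hX; rewrite linearB linearZ /= tr ts mulr1.
  rewrite (bigID (fun k => 0 < d k)) /= -EE -[X in _ = _ + X]opprK -sumrN -/F => h.
  by rewrite rmorphB rmorphD rmorph1 -addrA -[gamma%:C - 1]opprB h; ring.
have F0 : 0 < F by rewrite FE ltcR; lra.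
(* After multiplying by F > 0, [key] reduces the claim to gamma E be <= F be, that is, to (gamma -
   1)(1 - E) >= 0. *)
rewrite -lecR rmorphM /= -(ler_pM2r F0); apply: le_trans key.
rewrite HH mulrBl [F * al]mulrC lerD2l lerN2 [be * F]mulrC ler_wpM2r //.
rewrite FE -rmorphM lecR; nra.
Qed.

End Hermitian.

(** * Equality of the two suprema *)

Theorem mainTheorem1 (R : realType) (gamma : R) (n m : nat)
    (N : {linear 'M[R[i]]_n -> 'M[R[i]]_m})
    (hgamma : 1 <= gamma) (hn : (2 <= n)%N) (hN : is_channel N) :
  contraction_coefficient gamma N =
  ereal_sup [set e | exists phi psi : 'cV[R[i]]_n,
    [/\ unit_vector phi, unit_vector psi, orthogonal_vectors phi psi
      & e = (hockey_stick gamma (N (ketbra phi)) (N (ketbra psi)))%:E]].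
Proof.
set pairs := [set e | exists phi psi, _].
apply/le_anti/andP; split; last first.
  apply: le_ereal_sup => _ [phi [psi [hphi hpsi hort ->]]].
  exists (ketbra phi), (ketbra psi).
  by rewrite hockey_stick_orthogonal // divr1; split => //; exact: ketbra_state.
apply: ge_ereal_sup => _ [rho [sigma [hrho hsigma E0 ->]]].
rewrite leNgt; apply/negP => hlt.
set r := _ / _ in hlt.
(* A real s between the supremum and r: the supremum itself if finite, r - 1 if it is -oo; +oo
   contradicts [hlt]. *)
have [s hs hsup] : exists2 s : R, s < r & (ereal_sup pairs <= s%:E)%E.
  case: (ereal_sup pairs) hlt => [s|//|_]; first by rewrite lte_fin; exists s.
  by exists (r - 1); rewrite ?ltrBlDr ?ltrDl ?leNye.
suff : hockey_stick gamma (N rho) (N sigma) <= s * hockey_stick gamma rho sigma.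
  by rewrite -ler_pdivrMr // leNgt hs.
apply: hockey_stick_channel_le => //; first by case: hN.
move=> phi psi hphi hpsi hort; rewrite -lee_fin; apply: le_trans hsup.
by apply: ereal_sup_ubound; exists phi, psi.
Qed.
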